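(* There is an absolute constant $c>0$ such that for every odd $n$ there is a mapping $\phi$ from $\mathrm{XOR}$ to $\mathrm{Majority}$ on $\{0,1\}^n$ with $\mathrm{avgStretch}(\phi)\le c\sqrt{n}$, i.e. $\mathrm{avgStretch}(\phi)=O(\sqrt n)$.
   Context: For $x,y\in\{0,1\}^n$, $|x|=\sum_i x_i$ and $\mathrm{dist}(x,y)=\sum_i|x_i-y_i|$. $\mathrm{XOR}(x)=\sum_i x_i \bmod 2$; $\mathrm{Majority}(x)=1$ if $|x|>n/2$ and $0$ otherwise. A mapping from $f$ to $g$ is a bijection $\phi:\{0,1\}^n\to\{0,1\}^n$ with $f(x)=g(\phi(x))$ for all $x$. The average stretch is $\mathrm{avgStretch}(\phi)=\mathbb{E}_{x,i}[\mathrm{dist}(\phi(x),\phi(x+e_i))]$ where $x\in\{0,1\}^n$ and $i\in[n]$ are independent and uniform, $e_i$ the $i$th standard basis vector, addition mod 2. *)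

(* Defs.v *)
From mathcomp Require Import all_boot all_order all_algebra.
From mathcomp Require Import reals.

Set Implicit Arguments.
Unset Strict Implicit.
Unset Printing Implicit Defensive.

Import Order.TTheory GRing.Theory Num.Theory.

Local Open Scope ring_scope.

Definition cube (n : nat) := {ffun 'I_n -> bool}.

Definition weight (n : nat) (x : cube n) : nat := (\sum_(i < n) x i)%N.

Definition dist (n : nat) (x y : cube n) : nat :=
  (\sum_(i < n) `|(x i : nat) - (y i : nat)|)%N.

Definition basis_vec (n : nat) (i : 'I_n) : cube n := [ffun j => j == i].

Definition cube_add (n : nat) (x y : cube n) : cube n :=
  [ffun j => x j (+) y j].

Definition XOR (n : nat) (x : cube n) : bool := odd (weight x).

(* [n < |x|.*2] is [|x| > n / 2] without rounding. *)
Definition Majority (n : nat) (x : cube n) : bool := (n < (weight x).*2)%N.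

Definition is_mapping (n : nat) (f g : cube n -> bool)
    (phi : cube n -> cube n) : Prop :=
  bijective phi /\ forall x, f x = g (phi x).

(* The pair (x, i) is uniform on [cube n * 'I_n], so x and i are independent
   and uniform. *)
Definition avgStretch (R : realType) (n : nat) (phi : cube n -> cube n) : R :=
  (\sum_(p : cube n * 'I_n)
      (dist (phi p.1) (phi (cube_add p.1 (basis_vec p.2))))%:R)
  / #|{: cube n * 'I_n}|%:R.

(* Main.v *)
(** Split the cube into symmetric chains.  For odd [n], a chain occupies the
    levels [k, ..., n - k], so it has as many odd points as points in the upper
    half; permuting every chain separately therefore maps XOR to Majority and
    moves each point by at most the size of its chain.  By the triangle
    inequality the average stretch is at most [1 + 2 E(|C(x)|)] where [C(x)] is
    the chain of a uniform [x].  In the recursive construction a chain of size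
    [s] yields chains of sizes [s + 1] and [s - 1], and
    [(s + 1)^3 + (s - 1)^3 = 2 s^3 + 6 s], whence [E(|C(x)|^2) = 3 n + 1]. *)
Require Import Defs.
From mathcomp Require Import all_boot all_order all_algebra.
From mathcomp Require Import reals.
From mathcomp Require Import zify ring lra.

Set Implicit Arguments.
Unset Strict Implicit.
Unset Printing Implicit Defensive.

Import Order.TTheory GRing.Theory Num.Theory.

Local Open Scope ring_scope.

(** * Hamming distance and bit flips *)

Lemma distE n (x y : cube n) : dist x y = (\sum_(i < n) (x i (+) y i))%N.
Proof. by apply: eq_bigr => i _; case: (x i); case: (y i). Qed.

Lemma distC n (x y : cube n) : dist x y = dist y x.
Proof. by rewrite !distE; apply: eq_bigr => i _; rewrite addbC. Qed.

Lemma dist_triangle n (y x z : cube n) : (dist x z <= dist x y + dist y z)%N.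
Proof.
rewrite !distE -big_split /=; apply: leq_sum => i _.
by case: (x i); case: (y i); case: (z i).
Qed.

Lemma dist_add_basis n (x : cube n) i : dist x (cube_add x (basis_vec i)) = 1%N.
Proof.
rewrite distE (bigD1 i) //= big1 => [|j ji]; rewrite !ffunE.
  by rewrite eqxx; case: (x i).
by rewrite (negbTE ji) addbF addbb.
Qed.

Lemma cube_add_basisK n (i : 'I_n) :
  involutive (fun x : cube n => cube_add x (basis_vec i)).
Proof. by move=> x; apply/ffunP => j; rewrite !ffunE addbK. Qed.

(** * Prepending a coordinate *)

Definition cube_cons n (b : bool) (x : cube n) : cube n.+1 :=
  [ffun i => oapp x b (unlift ord0 i)].

Lemma cube_cons0 n b (x : cube n) : cube_cons b x ord0 = b.
Proof. by rewrite ffunE unlift_none. Qed.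

Lemma cube_consS n b (x : cube n) i : cube_cons b x (lift ord0 i) = x i.
Proof. by rewrite ffunE liftK. Qed.

Lemma cube_consP n (x : cube n.+1) : exists b y, x = cube_cons b y.
Proof.
exists (x ord0), [ffun i => x (lift ord0 i)]; apply/ffunP => i.
by rewrite ffunE; case: unliftP => [j|] -> //=; rewrite ffunE.
Qed.

Lemma cube_cons_inj n b : injective (@cube_cons n b).
Proof.
move=> x y /ffunP xy; apply/ffunP => i.
by rewrite -(cube_consS b x) xy cube_consS.
Qed.

Lemma weight_cons n b (x : cube n) : weight (cube_cons b x) = (b + weight x)%N.
Proof.
rewrite /weight big_ord_recl cube_cons0; congr (_ + _)%N.
by apply: eq_bigr => i _; rewrite cube_consS.
Qed.

Lemma dist_cons n a b (x y : cube n) :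
  dist (cube_cons a x) (cube_cons b y) = ((a (+) b) + dist x y)%N.
Proof.
rewrite !distE big_ord_recl !cube_cons0; congr (_ + _)%N.
by apply: eq_bigr => i _; rewrite !cube_consS.
Qed.

(** * Symmetric chain decomposition *)

(* The empty chain is allowed, at level [k = (n + 1) / 2].  The last conjunct
   says that any two points of the chain are comparable: one of the truncated
   differences vanishes. *)
Definition sym_chain n (C : seq (cube n)) : Prop :=
  exists k : nat, [/\ (k.*2 + size C = n.+1)%N,
    map (@weight n) C = iota k (size C) &
    {in C &, forall x y,
       dist x y <= (weight x - weight y) + (weight y - weight x)}%N].

(** The de Bruijn-Tengbergen-Kruyswijk step: the lifted top point joins the copy of [C] with new bit
    [false], which keeps both chains symmetric. A singleton also yields an empty chain, so every
    nonempty chain gives sizes s + 1 and s - 1. *)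
Definition chain_step n (C : seq (cube n)) : seq (seq (cube n.+1)) :=
  if C is x :: C' then
    [:: rcons (map (cube_cons false) C) (cube_cons true (last x C'));
        map (cube_cons true) (belast x C')]
  else [::].

Lemma sym_chain_step n (C : seq (cube n)) D :
  sym_chain C -> D \in chain_step C -> sym_chain D.
Proof.
case: C => [|x C] // [k [kC wC dC]]; rewrite /chain_step !inE.
have lC : last x C \in x :: C by rewrite mem_last.
have wl : weight (last x C) = (k + size C)%N.
  have -> : weight (last x C) = last (weight x) (map (@weight n) C).
    by rewrite last_map.
  case: wC => -> ->; elim: (size C) (k) => [|m IH] j /=; first by rewrite addn0.
  by rewrite IH addSnnS.
(* The lifted top gains one in distance and one in weight; the truncated difference absorbs this
   only because no point of the chain is heavier than the old top. *)
have wle y : y \in x :: C -> (weight y <= weight (last x C))%N.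
  move=> /(map_f (@weight n)); rewrite [map _ _]wC mem_iota wl /=; lia.
have wfalse : map (@weight n.+1) (map (cube_cons false) (x :: C)) =
    iota k (size C).+1.
  by rewrite -[RHS]wC -map_comp; apply: eq_map => y; rewrite /= weight_cons.
have wbel : map (@weight n) (belast x C) = iota k (size C).
  move: wC; rewrite lastI map_rcons size_rcons size_belast.
  by rewrite -addn1 iotaD cats1 => /rcons_inj [].
case/orP => /eqP ->.
  exists k; split.
  - by rewrite size_rcons /= size_map; move: kC => /=; lia.
  - rewrite map_rcons wfalse size_rcons size_map [size _]/=.
    rewrite weight_cons wl -cats1 -[(size C).+2]addn1.
    by rewrite iotaD (addnS k).
  - move=> y z; rewrite mem_rcons in_cons => /predU1P[->|/mapP[y' yC ->]];
    rewrite mem_rcons in_cons => /predU1P[->|/mapP[z' zC ->]];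
    rewrite dist_cons !weight_cons /=.
    + by have := dC _ _ lC lC; lia.
    + by have := dC _ _ lC zC; have := wle _ zC; lia.
    + by have := dC _ _ yC lC; have := wle _ yC; lia.
    + by have := dC _ _ yC zC; lia.
exists k.+1; split.
- by rewrite size_map size_belast; move: kC => /=; lia.
- rewrite size_map size_belast -[k.+1]add1n iotaDl -wbel -!map_comp.
  by apply: eq_map => y; rewrite /= weight_cons.
- move=> _ _ /mapP[y /mem_belast yC ->] /mapP[z /mem_belast zC ->].
  by rewrite dist_cons !weight_cons /=; have := dC _ _ yC zC; lia.
Qed.

(** Each step only moves the lifted top from one copy of the chain to the other, so no point is lost
    or repeated. *)
Lemma perm_flatten_step n (cs : seq (seq (cube n))) :
  perm_eq (flatten (flatten (map (@chain_step n) cs)))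
    (map (cube_cons false) (flatten cs) ++ map (cube_cons true) (flatten cs)).
Proof.
elim: cs => [|[|x C] cs IH] //=.
rewrite -cats1 !map_cat; apply/permP => a; have /permP/(_ a) := IH.
have := congr1 (fun s => count a (map (cube_cons true) s)) (lastI x C).
rewrite /= map_rcons -cats1 /= !(count_cat, map_cat) /= !count_cat /=; lia.
Qed.

Lemma sum_size_partition n (cs : seq (seq (cube n))) :
  perm_eq (flatten cs) (enum {: cube n}) -> (\sum_(C <- cs) size C = 2 ^ n)%N.
Proof.
move/perm_size; rewrite -cardE card_ffun card_bool card_ord.
by rewrite size_flatten sumnE big_map.
Qed.

(** A chain of size s counts s^2 once for each of its s points, so the sum of cubes is 2^n times the
    second moment of the chain size at a uniform point. *)
Lemma sym_chain_decomposition n : exists cs : seq (seq (cube n)),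
  [/\ perm_eq (flatten cs) (enum {: cube n}),
      forall C, C \in cs -> sym_chain C &
      (\sum_(C <- cs) size C ^ 3 = 2 ^ n * (3 * n).+1)%N].
Proof.
elim: n => [|n [cs [pcs ccs scs]]].
  have e (x : cube 0) : x = [ffun => false] by apply/ffunP; case.
  exists [:: [:: [ffun => false]]]; split.
  - apply: uniq_perm; rewrite ?enum_uniq // => x.
    by rewrite mem_enum (e x) /= inE eqxx.
  - move=> C; rewrite inE => /eqP ->; exists 0%N.
    split=> //=; first by rewrite /weight big_ord0.
    by move=> x y _ _; rewrite distE big_ord0.
  - by rewrite big_seq1.
exists (flatten (map (@chain_step n) cs)); split.
- apply: (perm_trans (perm_flatten_step cs)).
  have U : uniq (flatten cs) by rewrite (perm_uniq pcs) enum_uniq.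
  apply: uniq_perm; [|exact: enum_uniq|move=> x].
    rewrite cat_uniq !map_inj_uniq ?U ?andbT //=; try exact: cube_cons_inj.
    apply/hasPn => _ /mapP[y _ ->]; apply/mapP => -[z _] /ffunP/(_ ord0).
    by rewrite !cube_cons0.
  rewrite mem_enum mem_cat; have [b [y ->]] := cube_consP x.
  have yF : y \in flatten cs by rewrite (perm_mem pcs) mem_enum.
  by case: b; rewrite (map_f _ yF) ?orbT.
- by move=> D /flatten_mapP[C /ccs cC]; exact: sym_chain_step.
- rewrite big_flatten big_map.
  (* For an empty chain both sides are 0. The sum of cubes T thus becomes 2 T + 6 * 2^n. *)
  rewrite (eq_bigr (fun C : seq _ => 2 * size C ^ 3 + 6 * size C)%N).
    rewrite big_split /= -!big_distrr /= scs (sum_size_partition pcs).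
    rewrite expnS; lia.
  move=> [|x C] _; rewrite /chain_step; first by rewrite big_nil.
  rewrite big_cons big_seq1 size_rcons !size_map size_belast [size _]/=.
  rewrite /= !expnS !expn0; lia.
Qed.

(** * Matching odd points with upper points *)

Lemma perm_eq_map_matching (S T : eqType) (f g : S -> T) (s : seq S) :
  perm_eq (map f s) (map g s) ->
  exists2 t, perm_eq t s & map g t = map f s.
Proof.
case: s => [|x s0]; first by exists [::].
set s := x :: s0 => /(perm_iotaP (g x))[I].
rewrite size_map => pI ->; exists (map (nth x s) I).
  by have := perm_map (nth x s) pI; rewrite map_nth_iota0 // take_size.
rewrite -map_comp; apply/eq_in_map => i.
by rewrite (perm_mem pI) mem_iota => /andP[_ i_s]; rewrite (nth_map x).
Qed.

(** A multiset of booleans is determined by its size and its number of [true]. *)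
Lemma perm_eq_map_bool (T : eqType) (f g : pred T) (s : seq T) :
  count f s = count g s -> perm_eq (map f s) (map g s).
Proof.
move=> fg; have tr (h : pred T) : count_mem true (map h s) = count h s.
  by rewrite count_map; apply: eq_count => x /=; rewrite eqb_id.
have fa (h : pred T) : count_mem false (map h s) = (size s - count h s)%N.
  rewrite count_map -(count_predC h s) addKn.
  by apply: eq_count => x /=; rewrite eqbF_neg.
by apply/allP => -[] _ /=; rewrite ?tr ?fa fg.
Qed.

Lemma count_odd_iota k m : count odd (iota k m.*2) = m.
Proof. by elim: m k => //= m IH k; rewrite IH; case: (odd k). Qed.

(** Here k + m = (n + 1) / 2, so the threshold n / 2 falls exactly between the two halves of the
    interval. *)
Lemma count_upper_iota n k m : (k.*2 + m.*2 = n.+1)%N ->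
  count (fun w => n < w.*2)%N (iota k m.*2) = m.
Proof.
move=> kmn; rewrite -addnn iotaD count_cat.
have /eqP -> : count (fun w => n < w.*2)%N (iota k m) == 0%N.
  by rewrite -leqn0 leqNgt -has_count; apply/hasPn => w; rewrite mem_iota; lia.
have : all (fun w => n < w.*2)%N (iota (k + m) m).
  by apply/allP => w; rewrite mem_iota; lia.
by rewrite all_count size_iota => /eqP.
Qed.

Lemma sym_chain_matching n (C : seq (cube n)) : odd n -> sym_chain C ->
  exists2 D, perm_eq D C & map (@Majority n) D = map (@XOR n) C.
Proof.
move=> n_odd [k [kC wC _]]; apply/perm_eq_map_matching/perm_eq_map_bool.
(* This is where odd [n] matters: the size is n + 1 - 2k. *)
have Ceven : size C = (size C)./2.*2 by lia.
have cw p : count (p \o @weight n) C = count p (iota k (size C)./2.*2).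
  by rewrite -Ceven -wC count_map.
rewrite (cw odd) (cw (fun w => n < w.*2)%N) count_odd_iota.
by rewrite count_upper_iota // -Ceven.
Qed.

(** Comparable points are as far apart as their levels, and the chain spans [size C] levels. *)
Lemma sym_chain_dist n (C : seq (cube n)) : sym_chain C ->
  {in C &, forall x y, dist x y <= size C}%N.
Proof.
move=> [k [_ wC dC]] x y xC yC; have := dC _ _ xC yC.
have /(map_f (@weight n)) := xC; have /(map_f (@weight n)) := yC.
rewrite wC !mem_iota; lia.
Qed.

(** [L] is the graph of the future mapping, built chain by chain; s points moving at most s each
    give the term s^2. *)
Lemma chains_matching n (cs : seq (seq (cube n))) : odd n ->
  (forall C, C \in cs -> sym_chain C) ->
  exists L : seq (cube n * cube n),
    [/\ perm_eq (unzip1 L) (flatten cs), perm_eq (unzip2 L) (flatten cs),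
        forall p, p \in L -> XOR p.1 = Majority p.2 &
        (\sum_(p <- L) dist p.1 p.2 <= \sum_(C <- cs) size C ^ 2)%N].
Proof.
move=> n_odd; elim: cs => [|C cs IH] ccs.
  by exists [::]; split; rewrite ?big_nil.
have [|L [L1 L2 LM Ld]] := IH.
  by move=> D Dcs; apply: ccs; rewrite inE Dcs orbT.
have cC : sym_chain C by apply: ccs; rewrite inE eqxx.
have [D DC MD] := sym_chain_matching n_odd cC.
have sD := perm_size DC.
exists (zip C D ++ L); split.
- by rewrite /unzip1 map_cat -/(unzip1 _) unzip1_zip ?sD //= perm_cat2l.
- by rewrite /unzip2 map_cat -/(unzip2 _) unzip2_zip ?sD //= perm_cat.
- move=> p; rewrite mem_cat => /orP[|/LM //].
  move=> /(nthP (p.1, p.1))[i]; rewrite size_zip sD minnn => iC.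
  rewrite nth_zip ?sD // => <- /=.
  by rewrite -(nth_map _ false) // -MD (nth_map p.1) ?sD.
- rewrite big_cat big_cons /= leq_add //.
  have -> : (size C ^ 2 = \sum_(p <- zip C D) size C)%N.
    by rewrite big_const_seq count_predT size_zip sD minnn iter_addn_0.
  rewrite big_seq [leqRHS]big_seq; apply: leq_sum => -[x y] xy.
  apply: (sym_chain_dist cC).
    by have := map_f fst xy; rewrite -/(unzip1 _) unzip1_zip ?sD.
  by have := map_f snd xy; rewrite -/(unzip2 _) unzip2_zip ?sD // (perm_mem DC).
Qed.

(** * Gluing the matchings into a bijection *)

Lemma bijection_of_graph (T : finType) (L : seq (T * T)) :
  perm_eq (unzip1 L) (enum T) -> perm_eq (unzip2 L) (enum T) ->
  exists2 phi : T -> T, bijective phi & forall p, p \in L -> phi p.1 = p.2.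
Proof.
move=> L1 L2; pose phi x := nth x (unzip2 L) (index x (unzip1 L)).
have U1 : uniq (unzip1 L) by rewrite (perm_uniq L1) enum_uniq.
have U2 : uniq (unzip2 L) by rewrite (perm_uniq L2) enum_uniq.
have in1 x : x \in unzip1 L by rewrite (perm_mem L1) mem_enum.
have lt2 x : (index x (unzip1 L) < size (unzip2 L))%N.
  by rewrite (perm_size L2) -(perm_size L1) index_mem.
exists phi.
  (* The default of [nth] in [phi] is its argument; both sides need a common default before
     uniqueness applies. *)
  apply: injF_bij => x y; rewrite /phi (set_nth_default x _ (lt2 y)).
  move/eqP; rewrite nth_uniq // => /eqP xy.
  by rewrite -(nth_index x (in1 x)) xy nth_index.
move=> p /(nthP p)[i iL <-]; rewrite /phi.
rewrite -(nth_map _ p.1 fst) // index_uniq ?size_map //.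
by rewrite (nth_map p).
Qed.

Lemma parity_majority_bijection n : odd n -> exists phi : cube n -> cube n,
  is_mapping (@XOR n) (@Majority n) phi /\
  exists cs : seq (seq (cube n)),
    [/\ (\sum_(x : cube n) dist x (phi x) <= \sum_(C <- cs) size C ^ 2)%N,
        (\sum_(C <- cs) size C = 2 ^ n)%N &
        (\sum_(C <- cs) size C ^ 3 = 2 ^ n * (3 * n).+1)%N].
Proof.
move=> n_odd; have [cs [pcs ccs cs3]] := sym_chain_decomposition n.
have [L [L1 L2 LM Ld]] := chains_matching n_odd ccs.
have {}L1 := perm_trans L1 pcs; have {}L2 := perm_trans L2 pcs.
have [phi phi_bij phiL] := bijection_of_graph L1 L2.
exists phi; split.
  split=> // x; have : x \in unzip1 L by rewrite (perm_mem L1) mem_enum.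
  by case/mapP => p pL ->; rewrite phiL // LM.
exists cs; split=> //; last exact: sum_size_partition.
apply: leq_trans Ld; rewrite -big_enum /= -(perm_big _ L1) big_map /=.
by rewrite big_seq [leqRHS]big_seq leq_sum // => p pL; rewrite phiL.
Qed.

(** * From chain sizes to average stretch *)

(** For M = 2^n this bounds the mean chain size by the root of its second moment 3n + 1, with a
    looser constant. *)
Lemma sum_size_square_le (R : rcfType) (I : Type) (r : seq I) (s : I -> nat)
    (M n : nat) : (0 < n)%N ->
  (\sum_(i <- r) s i = M)%N -> (\sum_(i <- r) s i ^ 3 = M * (3 * n).+1)%N ->
  (\sum_(i <- r) s i ^ 2)%N%:R <= 5%:R / 2%:R * Num.sqrt n%:R * M%:R :> R.
Proof.
move=> n_gt0 s1 s3; set q := Num.sqrt n%:R.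
have qq : q ^+ 2 = n%:R by rewrite sqr_sqrtr ?ler0n.
have n1 : (1 : R) <= n%:R by rewrite ler1n.
have q_gt0 : 0 < q by rewrite sqrtr_gt0 ltr0n.
(* AM-GM: [2 q s^2 <= s^3 + q^2 s] *)
have : 2%:R * q * (\sum_(i <- r) s i ^ 2)%N%:R <=
    (\sum_(i <- r) s i ^ 3)%N%:R + q ^+ 2 * (\sum_(i <- r) s i)%N%:R.
  rewrite !natr_sum !mulr_sumr -big_split /=; apply: ler_sum => i _.
  rewrite !natrX; have : 0 <= (s i)%:R * ((s i)%:R - q) ^+ 2.
    by rewrite mulr_ge0 ?sqr_ge0.
  nra.
rewrite s1 s3 -[(3 * n).+1]addn1 natrM natrD natrM => le.
rewrite -(ler_pM2l q_gt0).
have M_ge0 : 0 <= M%:R :> R by [].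
(* Since 1 <= n, the bound (3n + 1) M + n M is at most 5 n M; dividing by 2q gives the factor
   5/2. *)
have : M%:R * 1 <= M%:R * n%:R :> R by rewrite ler_wpM2l.
have -> : q * (5%:R / 2%:R * q * M%:R) = 5%:R / 2%:R * n%:R * M%:R.
  by rewrite -qq; field.
move: le; rewrite qq; lra.
Qed.

(** Go from [phi x] to [x], flip a bit, then go to the image of the new point. The flip costs 1, and
    the outer legs have equal averages because flipping a fixed bit permutes the cube. *)
Lemma avgStretch_le_displacement (R : realType) n (phi : cube n -> cube n) :
  (0 < n)%N ->
  avgStretch R phi <=
    1 + 2%:R * (\sum_(x : cube n) dist x (phi x))%N%:R / (2 ^ n)%N%:R.
Proof.
move=> n_gt0; set S := (\sum_x _)%N.
have N_gt0 : (0 < 2 ^ n)%N by rewrite expn_gt0.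
rewrite /avgStretch card_prod card_ffun card_bool card_ord -natr_sum.
rewrite ler_pdivrMr ?ltr0n ?muln_gt0 ?N_gt0 //.
(* Clearing denominators leaves an inequality between natural numbers. *)
have -> : (1 + 2%:R * S%:R / (2 ^ n)%N%:R) * (2 ^ n * n)%N%:R =
    (n * (2 ^ n + 2 * S))%N%:R :> R.
  rewrite natrM natrM natrD natrM; field.
  by rewrite pnatr_eq0 -lt0n.
rewrite ler_nat.
rewrite -(pair_bigA _ (fun x i =>
  dist (phi x) (phi (cube_add x (basis_vec i))))).
rewrite exchange_big /=.
have -> : (n * (2 ^ n + 2 * S) = \sum_(i < n) (2 ^ n + 2 * S))%N.
  by rewrite sum_nat_const card_ord.
apply: leq_sum => i _; set e := fun x => cube_add x (basis_vec i).
have Se : S = (\sum_x dist (e x) (phi (e x)))%N.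
  exact: (reindex_inj (inv_inj (cube_add_basisK i))).
have -> : (2 ^ n + 2 * S =
    \sum_(x : cube n)
      (dist x (phi x) + dist x (e x) + dist (e x) (phi (e x))))%N.
  rewrite !big_split /= -Se -/S.
  under [X in (S + X + S)%N]eq_bigr => x _ do rewrite dist_add_basis.
  rewrite sum1_card card_ffun card_bool card_ord; lia.
apply: leq_sum => x _.
apply: leq_trans (dist_triangle (e x) _ _) _; rewrite leq_add2r.
by apply: leq_trans (dist_triangle x _ _) _; rewrite distC.
Qed.

Theorem theorem1p2 (R : realType) :
  exists c : R, 0 < c /\
    forall n : nat, odd n ->
      exists phi : cube n -> cube n,
        is_mapping (@XOR n) (@Majority n) phi /\
        avgStretch R phi <= c * Num.sqrt n%:R.
Proof.
(* The bound 1 + 2 * (5/2) * sqrt n is at most 6 * sqrt n, as sqrt n >= 1. *)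
exists 6%:R; split; first by rewrite ltr0n.
move=> n n_odd.
have [phi [phiM [cs [dS s1 s3]]]] := parity_majority_bijection n_odd.
have n_gt0 := odd_gt0 n_odd.
exists phi; split=> //.
apply: (le_trans (avgStretch_le_displacement R phi n_gt0)).
have S_le := sum_size_square_le R n_gt0 s1 s3.
have q_ge1 : 1 <= Num.sqrt n%:R :> R.
  by rewrite -[leLHS]sqrtr1 ler_sqrt ?ler1n.
have N_gt0 : 0 < (2 ^ n)%N%:R :> R by rewrite ltr0n expn_gt0.
have le : (\sum_(x : cube n) dist x (phi x))%N%:R / (2 ^ n)%N%:R <=
    5%:R / 2%:R * Num.sqrt n%:R :> R.
  by rewrite ler_pdivrMr //; apply: le_trans S_le; rewrite ler_nat.
rewrite -mulrA; lra.
Qed.
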